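(* Let $q$ be a prime power, and let $Z(\mathbb{F}_q)\subset\mathbb{F}_q^7$ be the set of points $(a_1,a_2,a_3,a_{12},a_{13},a_{23},a_{123})$ satisfying $$a_{123}^2-a_{123}(a_{12}a_3+a_{13}a_2+a_{23}a_1-a_1a_2a_3)+\bigl(a_1^2+a_2^2+a_3^2+a_{12}^2+a_{13}^2+a_{23}^2-a_1a_2a_{12}-a_1a_3a_{13}-a_2a_3a_{23}+a_{12}a_{13}a_{23}-4\bigr)=0.$$ Let $\pi\colon SL(2,\mathbb{F}_q)^3\to \mathbb{F}_q^7$ be the map $$\pi(x,y,u)=(\operatorname{tr}(x),\operatorname{tr}(y),\operatorname{tr}(u),\operatorname{tr}(xy),\operatorname{tr}(xu),\operatorname{tr}(yu),\operatorname{tr}(xyu)),$$ whose image is contained in $Z(\mathbb{F}_q)$. Then for every point $z\in Z(\mathbb{F}_q)$ the set $\pi^{-1}(z)\subset SL(2,\mathbb{F}_q)^3$ is nonempty.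
   Context: $\mathbb{F}_q$ is the finite field with $q$ elements; $\operatorname{tr}$ is the trace of a $2\times2$ matrix. The coordinates of $\mathbb{F}_q^7$ are ordered as $(a_1,a_2,a_3,a_{12},a_{13},a_{23},a_{123})$. *)

(* Defs.v *)
From mathcomp Require Import all_boot all_order all_algebra.

Set Implicit Arguments.
Unset Strict Implicit.
Unset Printing Implicit Defensive.

Import GRing.Theory.
Local Open Scope ring_scope.

(* A point of F^7 is a row vector whose entries 0, ..., 6 are
   (a_1, a_2, a_3, a_12, a_13, a_23, a_123). *)

Definition SL2 (F : finFieldType) : {set 'M[F]_2} := [set x | \det x == 1].

Definition SL2_cubed (F : finFieldType) : {set 'M[F]_2 * 'M[F]_2 * 'M[F]_2} :=
  setX (setX (SL2 F) (SL2 F)) (SL2 F).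

Definition fricke_poly (R : comPzRingType) (a1 a2 a3 a12 a13 a23 a123 : R) : R :=
  a123 ^+ 2 - a123 * (a12 * a3 + a13 * a2 + a23 * a1 - a1 * a2 * a3)
  + (a1 ^+ 2 + a2 ^+ 2 + a3 ^+ 2 + a12 ^+ 2 + a13 ^+ 2 + a23 ^+ 2
     - a1 * a2 * a12 - a1 * a3 * a13 - a2 * a3 * a23
     + a12 * a13 * a23 - 4%:R).

Definition fricke_Z (F : finFieldType) : {set 'rV[F]_7} :=
  [set a : 'rV[F]_7 | let c k := a 0 (inord k : 'I_7) in
    fricke_poly (c 0%N) (c 1%N) (c 2%N) (c 3%N) (c 4%N) (c 5%N) (c 6%N) == 0].

(* Defined on all triples of matrices; its domain is cut down to SL2_cubed F
   wherever it is used. *)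
Definition trace_map (F : finFieldType) (t : 'M[F]_2 * 'M[F]_2 * 'M[F]_2) :
    'rV[F]_7 :=
  let: (x, y, u) := t in
  \row_(i < 7) [:: \tr x; \tr y; \tr u; \tr (x *m y); \tr (x *m u);
                   \tr (y *m u); \tr (x *m y *m u)]`_i.

Definition trace_fiber (F : finFieldType) (z : 'rV[F]_7) :
    {set 'M[F]_2 * 'M[F]_2 * 'M[F]_2} :=
  [set t in SL2_cubed F | trace_map t == z].

(* Main.v *)
Require Import Defs.
From mathcomp Require Import all_boot all_order all_algebra.
From mathcomp Require Import ring.

(** Let D12 = a1^2 + a2^2 + a12^2 - a1 a2 a12 - 4. When x and y have traces
    a1, a2, a12 and D12 <> 0, the matrices 1, x, y, xy form a basis on which the
    trace form is nondegenerate, so the remaining coordinates determine u, and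
    the Fricke relation reads D12 * (1 - det u) = 0. A suitable pair (x, y) is
    a point of a conic over a finite field. Cyclic symmetry covers D13 and D23.

    Suppose D12 = D13 = D23 = 0. If a1^2 <> 4, then y and u are sought in the
    commutative algebra F[x], where they are determined by their traces and
    their traces against x. Either this triple is a solution, or the defect in
    a23 together with the Fricke relation puts an eigenvalue of x in F, and
    triangular matrices solve the problem. If a1^2 = a2^2 = a3^2 = 4, scalar
    matrices +-1 do. *)

Set Implicit Arguments.
Unset Strict Implicit.
Unset Printing Implicit Defensive.

Import GRing.Theory.
Local Open Scope ring_scope.

(** * Trace identities for two by two matrices *)

Section Matrices22.

Variable R : comPzRingType.

Definition mx22 (a b c d : R) : 'M[R]_2 :=
  \matrix_(i, j) if i == 0 then (if j == 0 then a else b)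
                 else (if j == 0 then c else d).

Lemma mx22_eta (x : 'M[R]_2) : x = mx22 (x 0 0) (x 0 1) (x 1 0) (x 1 1).
Proof.
apply/matrixP=> i j; rewrite mxE.
by case: i => [[|[|//]]] ?; case: j => [[|[|//]]] ? /=;
   congr (x _ _); apply: val_inj.
Qed.

Lemma mxtrace_mx22 a b c d : \tr (mx22 a b c d) = a + d.
Proof. by rewrite /mxtrace !big_ord_recl big_ord0 !mxE /= addr0. Qed.

Lemma mulmx22 a b c d a' b' c' d' :
  mx22 a b c d *m mx22 a' b' c' d' =
  mx22 (a * a' + b * c') (a * b' + b * d') (c * a' + d * c') (c * b' + d * d').
Proof.
apply/matrixP=> i j; rewrite !mxE !big_ord_recl big_ord0 !mxE /= addr0.
by case: (i == 0); case: (j == 0).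
Qed.

Lemma det_mx22 a b c d : \det (mx22 a b c d) = a * d - b * c.
Proof.
rewrite (expand_det_row _ 0) !big_ord_recl big_ord0 /cofactor !det_mx11 !mxE /=.
by rewrite addr0 expr0 expr1 mul1r mulN1r mulrN.
Qed.

Definition mx22E := (mulmx22, mxtrace_mx22, det_mx22).

(* The Fricke relation made homogeneous of degree 2 in each of x, y and u. *)
Lemma homogeneous_fricke (x y u : 'M[R]_2) :
  let a1 := \tr x in let a2 := \tr y in let a3 := \tr u in
  let a12 := \tr (x *m y) in let a13 := \tr (x *m u) in
  let a23 := \tr (y *m u) in let a123 := \tr (x *m y *m u) in
  a123 ^+ 2 - a123 * (a12 * a3 + a13 * a2 + a23 * a1 - a1 * a2 * a3)
  + (a1 ^+ 2 * (\det y * \det u) + a2 ^+ 2 * (\det x * \det u)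
     + a3 ^+ 2 * (\det x * \det y) + a12 ^+ 2 * \det u + a13 ^+ 2 * \det y
     + a23 ^+ 2 * \det x - a1 * a2 * a12 * \det u - a1 * a3 * a13 * \det y
     - a2 * a3 * a23 * \det x + a12 * a13 * a23
     - 4%:R * (\det x * \det y * \det u)) = 0.
Proof. by rewrite (mx22_eta x) (mx22_eta y) (mx22_eta u) !mx22E; ring. Qed.

Lemma fricke_poly_tr (x y u : 'M[R]_2) :
  \det x = 1 -> \det y = 1 -> \det u = 1 ->
  fricke_poly (\tr x) (\tr y) (\tr u) (\tr (x *m y)) (\tr (x *m u))
    (\tr (y *m u)) (\tr (x *m y *m u)) = 0.
Proof.
move=> dx dy du; have := homogeneous_fricke x y u.
by rewrite /= dx dy du => E; rewrite -[RHS]E /fricke_poly; ring.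
Qed.

(** For [x], [y] of determinant 1 this is the trace of their commutator minus 2; it vanishes exactly
    when they share an eigenvector over an algebraic closure. *)
Definition markov_disc (a1 a2 a12 : R) : R :=
  a1 ^+ 2 + a2 ^+ 2 + a12 ^+ 2 - a1 * a2 * a12 - 4%:R.

Lemma markov_disc_sym (a b c : R) :
  markov_disc a b c = markov_disc b a c.
Proof. by rewrite /markov_disc; ring. Qed.

Lemma fricke_poly_cyclic (a1 a2 a3 a12 a13 a23 a123 : R) :
  fricke_poly a2 a3 a1 a23 a12 a13 a123 = fricke_poly a1 a2 a3 a12 a13 a23 a123.
Proof. by rewrite /fricke_poly; ring. Qed.

Definition traces_realizable (a1 a2 a3 a12 a13 a23 a123 : R) : Prop :=
  exists x y u : 'M[R]_2,
    [/\ \det x = 1, \det y = 1, \det u = 1 &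
    [/\ \tr x = a1, \tr y = a2 & \tr u = a3] /\
    [/\ \tr (x *m y) = a12, \tr (x *m u) = a13, \tr (y *m u) = a23 &
        \tr (x *m y *m u) = a123]].

Lemma traces_realizable_cyclic (a1 a2 a3 a12 a13 a23 a123 : R) :
  traces_realizable a2 a3 a1 a23 a12 a13 a123 ->
  traces_realizable a1 a2 a3 a12 a13 a23 a123.
Proof.
move=> [y [u [x [dy du dx [[ty tu tx] [tyu tyx tux tyux]]]]]].
exists x, y, u; split=> //; split=> //; split=> //.
- by rewrite mxtrace_mulC.
- by rewrite mxtrace_mulC.
- by rewrite -mulmxA mxtrace_mulC.
Qed.

End Matrices22.

(** * Realizing traces over an arbitrary field *)

Section Field.

Variable F : fieldType.

Lemma sqr_eq4 (a : F) : a ^+ 2 = 4%:R -> exists2 e : F, e ^+ 2 = 1 & a = 2%:R * e.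
Proof.
move=> a4; have /eqP : (a - 2%:R) * (a + 2%:R) = 0 by rewrite -(subrr 4%:R) -{1}a4; ring.
rewrite mulf_eq0 => /orP[]/eqP h.
- by exists 1; [ring | rewrite -[LHS](subrK 2%:R) h; ring].
- by exists (-1); [ring | rewrite -[LHS](addrK 2%:R) h; ring].
Qed.

(* The trace conditions form a linear system for u, whose determinant is
   +-(m^2 + n^2 + a m n) = +-markov_disc. *)
Lemma traces_realizable_irreducible_pair (a a2 a3 a12 a13 a23 a123 r s : F) :
  s ^+ 2 - a2 * s + r ^+ 2 + a12 * r - a * r * s + 1 = 0 ->
  markov_disc a a2 a12 != 0 ->
  fricke_poly a a2 a3 a12 a13 a23 a123 = 0 ->
  traces_realizable a a2 a3 a12 a13 a23 a123.
Proof.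
move=> conic D0 fr.
(* With [x] the companion matrix of [t^2 - a t + 1], the traces of [y] and [xy] force [p] and [q];
   then [conic] says that [y] has determinant 1. *)
pose p := a2 - s; pose q := a12 + r - a * s.
pose m := s - p - a * r; pose n := q + r; pose E := m ^+ 2 + n ^+ 2 + a * m * n.
have ED : markov_disc a a2 a12 = E.
  rewrite -[LHS]addr0 -(mulr0 (4%:R - a ^+ 2)) -conic.
  by rewrite /markov_disc /E /m /n /p /q; ring.
have E0 : E != 0 by rewrite -ED.
(* The traces of [u] and [xu] fix its top row in terms of [g], [h]; Cramer's rule solves the
   remaining two equations. *)
pose A := a23 - p * a3 - r * a13; pose B := a123 + r * a3 - (p + a * r) * a13.
pose h := (A * m + B * n) / E; pose g := (A * (n + a * m) - B * m) / E.
have hg1 : m * h + n * g = A.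
  by rewrite /h /g !mulrA -mulrDl; apply: (canLR (mulfK E0)); rewrite /E; ring.
have hg2 : (n + a * m) * h - m * g = B.
  by rewrite /h /g !mulrA -mulrBl; apply: (canLR (mulfK E0)); rewrite /E; ring.
pose x := mx22 0 (- 1) 1 a; pose y := mx22 p q r s.
pose u := mx22 (a3 - h) (a13 + g - a * h) g h.
have dx : \det x = 1 by rewrite mx22E; ring.
have dy : \det y = 1.
  by rewrite mx22E -[LHS]addr0 -conic /p /q; ring.
have tx : \tr x = a by rewrite mx22E; ring.
have ty : \tr y = a2 by rewrite mx22E /p; ring.
have tu : \tr u = a3 by rewrite mx22E; ring.
have txy : \tr (x *m y) = a12 by rewrite !mx22E /p /q; ring.
have txu : \tr (x *m u) = a13 by rewrite !mx22E; ring.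
have tyu : \tr (y *m u) = a23.
  have -> : a23 = A + p * a3 + r * a13 by rewrite /A; ring.
  by rewrite !mx22E -hg1 /m /n; ring.
have txyu : \tr (x *m y *m u) = a123.
  have -> : a123 = B - r * a3 + (p + a * r) * a13 by rewrite /B; ring.
  by rewrite !mx22E -hg2 /m /n; ring.
exists x, y, u; split=> //.
have := homogeneous_fricke x y u.
rewrite /= dx dy tx ty tu txy txu tyu txyu => H.
have : markov_disc a a2 a12 * (\det u - 1) = 0.
  by rewrite -[RHS]subr0 -{1}H -fr /fricke_poly /markov_disc; ring.
by move/eqP; rewrite mulf_eq0 (negPf D0) subr_eq0 => /eqP.
Qed.

(** [a^2 - 4] is the determinant of the trace form on [F[x]] in the basis [1, x]. *)
Lemma traces_realizable_semisimple (a a2 a3 a12 a13 a23 a123 : F) :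
  a ^+ 2 != 4%:R ->
  markov_disc a a2 a12 = 0 -> markov_disc a a3 a13 = 0 ->
  markov_disc a2 a3 a23 = 0 ->
  fricke_poly a a2 a3 a12 a13 a23 a123 = 0 ->
  traces_realizable a a2 a3 a12 a13 a23 a123.
Proof.
rewrite -subr_eq0 => c0 D12 D13 D23 fr; set c := a ^+ 2 - 4%:R in c0.
have in_alg b ab : markov_disc a b ab = 0 -> exists p q : F,
    [/\ 2%:R * p + q * a = b, p * a + q * (a ^+ 2 - 2%:R) = ab &
        p ^+ 2 + p * q * a + q ^+ 2 = 1].
  move=> D.
  (* Cramer's rule for the matrix [p + q x] with trace [b] and trace [ab] against [x]. Its
     determinant [N] is [p^2 + p q a + q^2], and [markov_disc a b ab = c (1 - N)]. *)
  pose p := ((a ^+ 2 - 2%:R) * b - a * ab) / c; pose q := (2%:R * ab - a * b) / c.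
  have tb : 2%:R * p + q * a = b by rewrite /p /q /c; field.
  have tab : p * a + q * (a ^+ 2 - 2%:R) = ab by rewrite /p /q /c; field.
  exists p, q; split=> //.
  apply/eqP; rewrite -subr_eq0; apply/eqP/(mulfI c0).
  rewrite mulr0 -[RHS]oppr0 -D -tb -tab /markov_disc /c; ring.
have [p2 [q2 [t2 t12 n2]]] := in_alg _ _ D12.
have [p3 [q3 [t3 t13 n3]]] := in_alg _ _ D13.
pose T23 := 2%:R * (p2 * p3 - q2 * q3) + (p2 * q3 + q2 * p3 + q2 * q3 * a) * a.
pose T123 := (p2 * p3 - q2 * q3) * a
  + (p2 * q3 + q2 * p3 + q2 * q3 * a) * (a ^+ 2 - 2%:R).
pose x := mx22 0 (- 1) 1 a.
pose y := mx22 p2 (- q2) q2 (p2 + q2 * a).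
pose u := mx22 p3 (- q3) q3 (p3 + q3 * a).
have dx : \det x = 1 by rewrite mx22E; ring.
have dy : \det y = 1 by rewrite mx22E -n2; ring.
have du : \det u = 1 by rewrite mx22E -n3; ring.
have tx : \tr x = a by rewrite mx22E; ring.
have ty : \tr y = a2 by rewrite mx22E -t2; ring.
have tu : \tr u = a3 by rewrite mx22E -t3; ring.
have txy : \tr (x *m y) = a12 by rewrite !mx22E -t12; ring.
have txu : \tr (x *m u) = a13 by rewrite !mx22E -t13; ring.
have tyu : \tr (y *m u) = T23 by rewrite !mx22E /T23; ring.
have txyu : \tr (x *m y *m u) = T123 by rewrite !mx22E /T123; ring.
have frT := fricke_poly_tr dx dy du.
rewrite tx ty tu txy txu tyu txyu in frT.
have [E|] := eqVneq a23 T23.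
  (* Since [x], [y], [u] commute, the Fricke quadratic in [a123] has [T123] as a double root. *)
  have sq0 : (a123 - T123) ^+ 2 = 0.
    rewrite -[RHS]subr0 -{1}fr -frT E /fricke_poly /T23 /T123.
    by rewrite -t2 -t3 -t12 -t13; ring.
  have E' : a123 = T123.
    by apply/eqP; rewrite -subr_eq0 -sqrf_eq0 sq0.
  by exists x, y, u; rewrite E E'.
rewrite -subr_eq0 => s0; set s := a23 - T23 in s0.
have DT : markov_disc a2 a3 T23 = 0.
  pose N2 := p2 ^+ 2 + p2 * q2 * a + q2 ^+ 2.
  pose N3 := p3 ^+ 2 + p3 * q3 * a + q3 ^+ 2.
  transitivity (4%:R * (N2 * N3 - 1) + a2 ^+ 2 * (1 - N3) + a3 ^+ 2 * (1 - N2)).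
    by rewrite /markov_disc /T23 /N2 /N3 -t2 -t3; ring.
  by rewrite /N2 /N3 n2 n3; ring.
(* [T23] and [a23] are distinct roots of one monic quadratic, whose roots sum to [a2 * a3]. *)
have a23E : a23 = a2 * a3 - T23.
  apply/eqP; rewrite -subr_eq0; apply/eqP/(mulfI s0); rewrite mulr0.
  by rewrite -[RHS]subr0 -{1}D23 -DT /s /markov_disc; ring.
(* In terms of [l], the Fricke relation becomes [s^2 (l^2 - a l + 1) = 0], so [l] is an eigenvalue
   of [x]. *)
pose l := (a123 - T123) / s.
have a123E : a123 = T123 + s * l by rewrite /l mulrC divfK //; ring.
have l_root : l ^+ 2 - a * l + 1 = 0.
  apply: (mulfI s0); apply: (mulfI s0); rewrite !mulr0.
  rewrite -[RHS]subr0 -{1}fr -frT a123E /s a23E /fricke_poly /T23 /T123.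
  by rewrite -t2 -t3 -t12 -t13; ring.
(* The diagonals are those of [p + q x]; the off-diagonal entries 1 and [s] add exactly [s] to the
   trace of [yu] and [s l] to that of [xyu]. *)
exists (mx22 l 0 0 (a - l)), (mx22 (p2 + q2 * l) 1 0 (p2 + q2 * (a - l))),
       (mx22 (p3 + q3 * l) 0 s (p3 + q3 * (a - l))).
rewrite !mx22E; split.
- by rewrite -[RHS]subr0 -[in RHS]l_root; ring.
- rewrite -[RHS]n2 -[RHS]subr0 -(mulr0 (q2 ^+ 2)) -[in RHS]l_root.
  by ring.
- rewrite -[RHS]n3 -[RHS]subr0 -(mulr0 (q3 ^+ 2)) -[in RHS]l_root.
  by ring.
split; split.
- by ring.
- by rewrite -t2; ring.
- by rewrite -t3; ring.
- by rewrite -t12 -[RHS]addr0 -(mulr0 (2%:R * q2)) -[in RHS]l_root; ring.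
- by rewrite -t13 -[RHS]addr0 -(mulr0 (2%:R * q3)) -[in RHS]l_root; ring.
- rewrite -[RHS](subrK T23) -/s -[RHS]addr0 -(mulr0 (2%:R * q2 * q3)) -[in RHS]l_root.
  by rewrite /T23; ring.
- rewrite a123E /T123 -[RHS]addr0.
  rewrite -(mulr0 (3%:R * a * q2 * q3 + 2%:R * (p2 * q3 + q2 * p3))) -[in RHS]l_root.
  by ring.
Qed.

(** The discriminants, and then the Fricke polynomial, become perfect squares, which force the
    traces of products of scalar matrices. *)
Lemma traces_realizable_scalar (a1 a2 a3 a12 a13 a23 a123 : F) :
  a1 ^+ 2 = 4%:R -> a2 ^+ 2 = 4%:R -> a3 ^+ 2 = 4%:R ->
  markov_disc a1 a2 a12 = 0 -> markov_disc a1 a3 a13 = 0 ->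
  markov_disc a2 a3 a23 = 0 ->
  fricke_poly a1 a2 a3 a12 a13 a23 a123 = 0 ->
  traces_realizable a1 a2 a3 a12 a13 a23 a123.
Proof.
move=> /sqr_eq4[e1 s1 ->] /sqr_eq4[e2 s2 ->] /sqr_eq4[e3 s3 ->].
have sqr0 (b : F) : b ^+ 2 = 0 -> b = 0 by move/eqP; rewrite sqrf_eq0 => /eqP.
have prodE (e f b : F) : e ^+ 2 = 1 -> f ^+ 2 = 1 ->
    markov_disc (2%:R * e) (2%:R * f) b = 0 -> b = 2%:R * (e * f).
  move=> ee ff D; apply/eqP; rewrite -subr_eq0; apply/eqP/sqr0.
  transitivity (markov_disc (2%:R * e) (2%:R * f) b
                + 4%:R * (e ^+ 2 - 1) * (f ^+ 2 - 1)).
    by rewrite /markov_disc; ring.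
  by rewrite D ee; ring.
move=> /prodE-> // /prodE-> // /prodE-> // fr.
pose x := e1%:M : 'M[F]_2; pose y := e2%:M : 'M[F]_2; pose u := e3%:M : 'M[F]_2.
have dx : \det x = 1 by rewrite det_scalar.
have dy : \det y = 1 by rewrite det_scalar.
have du : \det u = 1 by rewrite det_scalar.
have frT := fricke_poly_tr dx dy du.
rewrite -!scalar_mxM !mxtrace_scalar in frT.
suff a123E : a123 = 2%:R * (e1 * e2 * e3).
  by exists x, y, u; split; rewrite // -!scalar_mxM !mxtrace_scalar a123E;
     do 2?split=> //; ring.
apply/eqP; rewrite -subr_eq0; apply/eqP/sqr0.
by rewrite -[RHS]subr0 -{1}fr -frT /fricke_poly; ring.
Qed.

End Field.

(** * Squares and conics over a finite field *)

Section FiniteField.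

Variable F : finFieldType.

(** A nonzero square has at most two roots and 0 has only one, whence the strict inequality. *)
Lemma card_squares : (#|F| < 2 * #|[set w ^+ 2 | w : F]|)%N.
Proof.
set S := [set _ | _ in _].
pose r (z : F) : F := odflt 0 [pick w | w ^+ 2 == z].
have rK (w : F) : (w == r (w ^+ 2)) || (w == - r (w ^+ 2)).
  rewrite -eqf_sqr /r; case: pickP => [v /eqP->//|/(_ w)]; by rewrite eqxx.
have S0 : 0 \in S by apply/imsetP; exists 0; rewrite ?expr0n.
pose S' := S :\ 0.
have cover : [set: F] \subset 0 |: (r @: S' :|: [set - r z | z in S']).
  apply/subsetP=> w _; rewrite !inE; have [//|w0 /=] := eqVneq w 0.
  have wS : w ^+ 2 \in S' by rewrite !inE expf_neq0 //=; apply: imset_f.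
  case/orP: (rK w) => /eqP->; apply/orP; [left|right]; apply/imsetP.
  - by exists (w ^+ 2).
  - by exists (w ^+ 2).
have := subset_leq_card cover; rewrite cardsT => /leq_ltn_trans; apply.
rewrite (cardsD1 0 S) S0 -/S' mulnDr addnC.
rewrite cardsU1; apply: leq_ltn_trans (_ : 1 + (#|S'| + #|S'|) < _)%N.
  apply: leq_add; first exact: leq_b1.
  apply: leq_trans (leq_card_setU _ _) _.
  by apply: leq_add; apply: leq_imset_card.
by rewrite mul2n -addnn addnC ltn_add2l.
Qed.

(** Both sides take more than half of the values in [F], so they meet. *)
Lemma two_squares (k b : F) : k != 0 -> exists v w : F, v ^+ 2 = k * w ^+ 2 + b.
Proof.
move=> k0; set S := [set w ^+ 2 | w : F].
pose T := [set k * z + b | z in S].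
have cT : #|T| = #|S| by apply: card_imset => z z' /addIr /(mulfI k0).
have : S :&: T != set0.
  rewrite -card_gt0 lt0n; apply/eqP => I0.
  have := cardsUI S T; rewrite I0 addn0 cT addnn -mul2n => cU.
  by have := card_squares; rewrite -/S -cU ltnNge max_card.
case/set0Pn=> z /setIP[/imsetP[v _ ->] /imsetP[z' /imsetP[w _ ->] e]].
by exists v, w.
Qed.

(** Signs disappear, so squaring is injective, hence bijective by finiteness. *)
Lemma sqrt_char2 (z : F) : 2%:R = 0 :> F -> exists w : F, w ^+ 2 = z.
Proof.
move=> two0.
have inj : injective (fun w : F => w ^+ 2).
  move=> v w /eqP; rewrite eqf_sqr => /orP[]/eqP-> //.
  by apply/eqP; rewrite -subr_eq0 -opprD -mulr2n -mulr_natl two0 mul0r oppr0.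
by exists (invF inj z); apply: (f_invF inj).
Qed.

Lemma conic_point (a a2 a12 : F) : markov_disc a a2 a12 != 0 -> exists r s : F,
  s ^+ 2 - a2 * s + r ^+ 2 + a12 * r - a * r * s + 1 = 0.
Proof.
have [/sqr_eq4[e e1 ->]|c0 _] := eqVneq (a ^+ 2) 4%:R.
  (* The quadratic part is (s - e r)^2, so the conic meets the line s = e r. *)
  have -> : markov_disc (2%:R * e) a2 a12
            = (a12 - e * a2) ^+ 2 + (4%:R - a2 ^+ 2) * (e ^+ 2 - 1).
    by rewrite /markov_disc; ring.
  rewrite e1 subrr mulr0 addr0 sqrf_eq0 => d0.
  exists (- (a12 - e * a2)^-1), (e * - (a12 - e * a2)^-1).
  set r := - _; have dr : (a12 - e * a2) * r = -1 by rewrite mulrN mulfV.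
  transitivity ((e ^+ 2 - 1) * - r ^+ 2 + (a12 - e * a2) * r + 1); first by ring.
  by rewrite e1 dr; ring.
have [two0|two0] := eqVneq (2%:R : F) 0.
  have a0 : a != 0.
    apply: contraNneq c0 => ->.
    by rewrite expr0n (natrM _ 2 2) two0 mul0r.
  (* This [r] cancels the terms linear in [s], leaving a single square root to extract. *)
  pose r := - a2 / a; have ar : a * r = - a2 by rewrite /r mulrC divfK.
  have [s sE] := sqrt_char2 (- (r ^+ 2 + a12 * r + 1)) two0.
  by exists r, s; rewrite ar sE; ring.
(* Completing the square in [s] gives [w^2 = c r^2 + b r + d]; completing it in [r] gives
   [v^2 = 4 c w^2 + b^2 - 4 c d] with [v = 2 c r + b]. *)
pose c := a ^+ 2 - 4%:R; pose b := 2%:R * a * a2 - 4%:R * a12.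
pose d := a2 ^+ 2 - 4%:R.
have cn0 : c != 0 by rewrite subr_eq0.
have four0 : 4%:R != 0 :> F by rewrite (natrM _ 2 2) mulf_neq0.
have [v [w vw]] := two_squares (b ^+ 2 - 4%:R * c * d) (mulf_neq0 four0 cn0).
pose r := (v - b) / (2%:R * c); pose s := (a2 + a * r + w) / 2%:R.
have vE : v = 2%:R * c * r + b by rewrite /r mulrC divfK ?mulf_neq0 // subrK.
have wE : w = 2%:R * s - a2 - a * r.
  by rewrite /s [2%:R * _]mulrC divfK //; ring.
exists r, s; apply: (mulfI four0); apply: (mulfI four0); apply: (mulfI cn0).
rewrite !mulr0 -(subrr (v ^+ 2)) {1}vw vE wE /b /c /d.
by ring.
Qed.

(** * Surjectivity onto the Fricke hypersurface *)

Lemma traces_realizable_disc_neq0 (a1 a2 a3 a12 a13 a23 a123 : F) :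
  markov_disc a1 a2 a12 != 0 ->
  fricke_poly a1 a2 a3 a12 a13 a23 a123 = 0 ->
  traces_realizable a1 a2 a3 a12 a13 a23 a123.
Proof.
move=> D0 fr; have [r [s conic]] := conic_point D0.
exact: traces_realizable_irreducible_pair conic D0 fr.
Qed.

Lemma fricke_realizable (a1 a2 a3 a12 a13 a23 a123 : F) :
  fricke_poly a1 a2 a3 a12 a13 a23 a123 = 0 ->
  traces_realizable a1 a2 a3 a12 a13 a23 a123.
Proof.
move=> fr.
have fr' : fricke_poly a2 a3 a1 a23 a12 a13 a123 = 0 by rewrite fricke_poly_cyclic.
have fr'' : fricke_poly a3 a1 a2 a13 a23 a12 a123 = 0 by rewrite fricke_poly_cyclic.
have [D12|] := eqVneq (markov_disc a1 a2 a12) 0; last first.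
  by move/traces_realizable_disc_neq0; apply.
have [D23|D0] := eqVneq (markov_disc a2 a3 a23) 0; last first.
  exact/traces_realizable_cyclic/traces_realizable_disc_neq0.
have [D13|D0] := eqVneq (markov_disc a1 a3 a13) 0; last first.
  do 2!apply: traces_realizable_cyclic.
  by apply: traces_realizable_disc_neq0 fr''; rewrite markov_disc_sym.
have [c1|c1] := eqVneq (a1 ^+ 2) 4%:R; last exact: traces_realizable_semisimple.
have [c2|c2] := eqVneq (a2 ^+ 2) 4%:R; last first.
  apply/traces_realizable_cyclic/traces_realizable_semisimple => //.
    by rewrite markov_disc_sym.
  by rewrite markov_disc_sym.
have [c3|c3] := eqVneq (a3 ^+ 2) 4%:R; last first.
  do 2!apply: traces_realizable_cyclic.
  by apply: traces_realizable_semisimple; rewrite // markov_disc_sym.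
exact: traces_realizable_scalar.
Qed.

End FiniteField.

Theorem mainTheorem2 (F : finFieldType) :
  (forall t : 'M[F]_2 * 'M[F]_2 * 'M[F]_2,
      t \in SL2_cubed F -> trace_map t \in fricke_Z F)
  /\ (forall z : 'rV[F]_7, z \in fricke_Z F -> trace_fiber z != set0).
Proof.
split=> [[[x y] u]|z].
  rewrite !inE /= => /andP[/andP[/eqP dx /eqP dy] /eqP du].
  by rewrite !mxE !inordK //= fricke_poly_tr.
rewrite inE => /eqP/fricke_realizable.
move=> [x [y [u [dx dy du [[tx ty tu] [txy txu tyu txyu]]]]]].
apply/set0Pn; exists (x, y, u); rewrite !inE /= dx dy du !eqxx /=.
apply/eqP/rowP => i; rewrite mxE tx ty tu txy txu tyu txyu -{2}(inord_val i).
by case: i => [[|[|[|[|[|[|[|//]]]]]]] ?].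
Qed.
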